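(* For every positive integer $k$ there exists a graph of girth at least $k$ that is cubical but not layered.
   Context: The $n$-dimensional hypercube $Q_n$ is the graph with vertex set $\{0,1\}^n$ in which two vertices are adjacent if and only if they differ in exactly one coordinate. The $k$-th layer of $Q_n$ is the subgraph of $Q_n$ induced by all vertices containing exactly $k$ or $k+1$ ones in their coordinate representation. A graph $G$ is cubical if there exists some $n$ such that $G$ is (isomorphic to) a subgraph, not necessarily induced, of $Q_n$. A graph $G$ is layered if there exist some $n$ and $k$ such that $G$ is (isomorphic to) a subgraph, not necessarily induced, of the $k$-th layer of $Q_n$. The girth of a graph is the length of its shortest cycle. *)

(* Defs.v *)
From mathcomp Require Import all_boot.

Set Implicit Arguments.
Unset Strict Implicit.
Unset Printing Implicit Defensive.

Record sgraph := SGraph {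
  vertex :> finType;
  adj : rel vertex;
  adj_sym : symmetric adj;
  adj_irr : irreflexive adj }.

(* Isomorphic to a not necessarily induced subgraph: the image of [f], with
   the images of the edges of [G], is the copy of [G] inside [H]. *)
Definition embeds_in (G H : sgraph) : Prop :=
  exists f : G -> H,
    injective f /\ forall x y : G, adj x y -> adj (f x) (f y).

Section Induced.
Variables (G : sgraph) (P : pred G).

Definition induced_adj : rel {x : G | P x} :=
  fun x y => adj (val x) (val y).

Lemma induced_adj_sym : symmetric induced_adj.
Proof. by move=> x y; apply: adj_sym. Qed.

Lemma induced_adj_irr : irreflexive induced_adj.
Proof. by move=> x; apply: adj_irr. Qed.

Definition induced : sgraph := SGraph induced_adj_sym induced_adj_irr.
End Induced.

Section Hypercube.
Variable n : nat.

Definition cube_adj : rel {ffun 'I_n -> bool} :=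
  fun x y => #|[set i | x i != y i]| == 1.

Lemma cube_adj_sym : symmetric cube_adj.
Proof.
move=> x y; rewrite /cube_adj; congr (#|pred_of_set _| == 1).
by apply/setP => i; rewrite !inE eq_sym.
Qed.

Lemma cube_adj_irr : irreflexive cube_adj.
Proof.
move=> x; rewrite /cube_adj (_ : [set i | _] = set0) ?cards0 //.
by apply/setP => i; rewrite !inE eqxx.
Qed.

Definition hypercube : sgraph := SGraph cube_adj_sym cube_adj_irr.

Definition ones (x : {ffun 'I_n -> bool}) : nat := #|[set i | x i]|.

Definition layer (k : nat) : sgraph :=
  @induced hypercube (fun x => (ones x == k) || (ones x == k.+1)).
End Hypercube.

Definition cubical (G : sgraph) : Prop :=
  exists n : nat, embeds_in G (hypercube n).

Definition layered (G : sgraph) : Prop :=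
  exists n k : nat, embeds_in G (layer n k).

Definition is_cycle (G : sgraph) (c : seq G) : bool :=
  [&& 2 < size c, cycle (@adj G) c & uniq c].

Definition has_cycle_of_length (G : sgraph) (m : nat) : bool :=
  [exists c : m.-tuple G, is_cycle c].

(* Cycles have at most [#|G|] vertices, so the search range is exhaustive;
   [None] is the infinite girth of an acyclic graph. *)
Definition girth (G : sgraph) : option nat :=
  ohead [seq m <- iota 0 #|G|.+1 | has_cycle_of_length G m].

Definition girth_at_least (G : sgraph) (k : nat) : bool :=
  if girth G is Some g then k <= g else true.

Lemma girth_at_leastP (G : sgraph) (k : nat) :
  reflect (forall c : seq G, is_cycle c -> k <= size c) (girth_at_least G k).
Proof.
have hasP (c : seq G) : is_cycle c ->
    size c \in [seq m <- iota 0 #|G|.+1 | has_cycle_of_length G m].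
  move=> cyc; rewrite mem_filter mem_iota /= add0n ltnS.
  have /and3P[_ _ Uc] := cyc.
  rewrite -(card_uniqP Uc) max_card andbT (card_uniqP Uc).
  by apply/existsP; exists (in_tuple c).
have := sorted_filter leq_trans (has_cycle_of_length G) (iota_sorted 0 #|G|.+1).
rewrite /girth_at_least /girth.
case def_s: [seq m <- _ | _] => [|g s] /= => [_|sorted_s].
  by apply: ReflectT => c /hasP; rewrite def_s.
apply: (iffP idP) => [le_kg d /hasP | le_k].
  rewrite def_s inE => /predU1P[-> // | s_d]; apply: leq_trans le_kg _.
  exact: (allP (order_path_min leq_trans sorted_s)).
have : g \in [seq m <- iota 0 #|G|.+1 | has_cycle_of_length G m].
  by rewrite def_s mem_head.
rewrite mem_filter => /andP[/existsP[c cyc_c] _].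
by have := le_k _ cyc_c; rewrite size_tuple.
Qed.

(* Main.v *)
Require Import Defs.
From HB Require Import structures.
From mathcomp Require Import all_boot ring zify.

Set Implicit Arguments.
Unset Strict Implicit.
Unset Printing Implicit Defensive.

(** Joining the vertices [u] and [v] of a layer by a path of length [d] only
    says that their images are at Hamming distance at most [d].  But a layer
    wastes half of this distance: if [u] and [v] lie on different sides, about
    half of the differing coordinates are 1 in [u] and the other half are 1 in
    [v].  In the whole cube all of them may be 1 in [v].  The proof builds
    sparse graphs in which this loss is fatal.

    The graph.  Fix an odd [J], and think of words of length [J] over an
    alphabet of [n] letters.  Erasing one letter of a word gives a facet; there
    are [J * n ^ J.-1] facets, far fewer than words.  Each facet [b] gets a hub,
    with [N] leaves, and all hubs are joined to one apex by disjoint paths of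
    length [J.+1].  A gadget is a word [w] with one leaf index [cc i] for each
    of its facets; it joins a vertex (the center of [w]) by paths of length 2
    to the chosen leaf of each of the [J] facets of [w].  In the cube
    one may take for a hub the set of letters of its facet, add one element to
    get a leaf, and take for the center the set of all letters of [w]: any set
    of gadgets gives a cubical graph ([gadget_graph_cubical]).

    Why it is not layered.  Let [e] be the coordinate in which a hub and one of
    its leaves differ.  In a layer, going from the leaf to the center of a gadget
    cannot restore [e], as otherwise the vertex in between would be mapped to
    the image of the hub ([layer_path3]).  So hub and center differ at [e].  The
    apex is close to the hub, hence it agrees with the hub at [e] for all but
    at most [J.+1] of the leaves.  If the [J] leaves of a gadget all have this
    property, and have distinct coordinates [e], then apex and center differ in
    [J] coordinates, with the same orientation.  By the loss described above
    ([opposite_sides]) this forces distance at least [2 * J - 1], while the path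
    through a hub has length [J + 4]: impossible for [J > 5].

    Which gadgets.  What an embedding does to hubs and leaves is summarized by
    a labelling of the pairs (facet, leaf index), and for every labelling every
    word carries some gadget that is fatal for it ([transversal_exists]).  Hence
    for any single word some choice of leaf indices kills a constant
    proportion of the labellings that have survived so far ([greedy_hitting]).
    The number of labellings is exponential in about [n ^ J.-1 * log n], so
    about [n ^ J.-1 * log n] gadgets suffice.  As there are [n ^ J] words, one
    can always use a word whose facets are pairwise far apart in the graph
    built so far ([exists_remote_word]), so that no short cycle arises
    ([cycles_ge_cons]). *)

(** * Cycles of graphs built vertex by vertex *)

Definition cycles_ge (T : eqType) (k : nat) (e : rel T) : Prop :=
  forall c : seq T, cycle e c -> uniq c -> 2 < size c -> k <= size c.

Lemma seq_max_height (T : eqType) (h : T -> nat) (x : T) (c : seq T) :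
  exists2 v, v \in x :: c & forall u, u \in x :: c -> h u <= h v.
Proof.
elim: c x => [|y c IHc] x.
  by exists x => [|u]; rewrite inE // => /eqP->.
have [v cv max_v] := IHc y; have [le_xv | lt_vx] := leqP (h x) (h v).
  exists v => [|u]; first by rewrite inE cv orbT.
  by rewrite inE => /predU1P[-> // | /max_v].
exists x => [|u]; first exact: mem_head.
by rewrite inE => /predU1P[-> // | /max_v/leq_trans-> //]; apply: ltnW.
Qed.

(** A rooted forest, given by a height function for which every vertex has at
    most one neighbour that is not higher than itself: the highest vertex of a
    cycle would have two. *)
Lemma cycles_ge_height (T : eqType) (h : T -> nat) (e : rel T) (k : nat) :
    symmetric e ->
    (forall v u u', e v u -> e v u' -> h u <= h v -> h u' <= h v -> u = u') ->
  cycles_ge k e.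
Proof.
move=> e_sym low_uniq [|x c] // cyc Uc sz_c.
have [v cv max_v] := seq_max_height h x c.
have [i c' def_c] := rot_to cv.
move: cyc Uc sz_c; rewrite -(rot_cycle i) -(rot_uniq i) -(size_rot i) def_c.
have {}max_v u : u \in v :: c' -> h u <= h v.
  by rewrite -def_c mem_rot => /max_v.
case: c' {def_c} max_v => [|u [|w p]] // max_v /= /and3P[vu _].
rewrite rcons_path => /andP[_]; rewrite /= e_sym => zv /and3P[_ + _] _.
have eq_u: u = last w p.
  by apply: (low_uniq v) => //; apply: max_v; rewrite !inE ?eqxx ?orbT ?mem_last //;
     have := mem_last w p; rewrite inE => ->; rewrite !orbT.
by rewrite {1}eq_u mem_last.
Qed.

(** A new cycle runs through [v], hence it contains a path between two distinct
    neighbours of [v] that avoids [v].  Keeping such paths long is the only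
    thing to care about when vertices are added one at a time. *)
Lemma cycles_ge_add_vertex (T : eqType) (k : nat) (v : T) (e e' : rel T) :
    symmetric e' ->
    (forall x y, x != v -> y != v -> e' x y -> e x y) ->
    cycles_ge k e ->
    (forall z p, e' v z -> e' v (last z p) -> z != last z p -> path e z p ->
       k <= size p) ->
  cycles_ge k e'.
Proof.
move=> e'_sym sub_e girth_e far c cyc Uc sz_c.
have sub_path x p : v \notin x :: p -> path e' x p -> path e x p.
  elim: p x => //= y p IHp x; rewrite !inE !negb_or => /and3P[vx vy vp].
  case/andP=> xy yp; rewrite sub_e 1?eq_sym //= IHp // inE negb_or vy //.
have [cv | c'v] := boolP (v \in c); last first.
  apply: girth_e => //; case: c c'v cyc {Uc sz_c} => [|x c] //= c'v.
  apply: sub_path; rewrite inE mem_rcons inE orbA orbb.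
  by rewrite inE in c'v.
have [i c' def_c] := rot_to cv.
move: cyc Uc sz_c; rewrite -(rot_cycle i) -(rot_uniq i) -(size_rot i) def_c.
case: c' {def_c} => [|z [|w p]] //; rewrite /cycle rcons_path.
case/andP=> /andP[vz zp] zv /andP[c'v /andP[z'p _]] _.
apply: leq_trans (far z (w :: p) vz _ _ _) _; last by rewrite /= ltnW.
- by rewrite e'_sym.
- by apply: contraNneq z'p; rewrite /= => ->; apply: mem_last.
exact: sub_path.
Qed.

(** * Greedy selection and estimates *)

Lemma leq_card_bigcup (I T : finType) (P : pred I) (F : I -> {set T}) (m : nat) :
  (forall i, P i -> #|F i| <= m) -> #|\bigcup_(i | P i) F i| <= #|P| * m.
Proof.
move=> leFm; rewrite -sum_nat_const.
elim/big_ind2: _ => [|A a B c leA leB|i /leFm //]; first by rewrite cards0.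
by apply: leq_trans (leq_card_setU _ _) _; rewrite leq_add.
Qed.

Lemma leq_expn2r (a b e : nat) : a <= b -> a ^ e <= b ^ e.
Proof. by case: e => // e; rewrite leq_exp2r. Qed.

(** Bernoulli's inequality in the form (1 - 1/p)^p <= 1/2, where p = q + 1:
    removing p times a proportion 1/p of a set at least halves it. *)
Lemma double_expn_leq (q : nat) : 2 * q ^ q.+1 <= q.+1 ^ q.+1.
Proof.
case: q => // q; have: 0 < q.+1 by []; move: q.+1 => p p_gt0.
have bern m : p ^ m * (p + m) <= p * p.+1 ^ m.
  elim: m => [|m IHm]; first by rewrite !expn0 addn0 mulnC.
  rewrite (expnS p) (expnS p.+1).
  by move: (p ^ m) (p.+1 ^ m) IHm => x y; nia.
have := bern p.+1; rewrite -(leq_pmul2l p_gt0).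
by move: (p ^ p.+1) (p.+1 ^ p.+1) => x y; nia.
Qed.

(** Whatever the element [w] that [good] allows, each surviving [t] is killed by
    [(w, c)] for at least one [c], so some [c] kills a proportion 1/#|C| of the
    survivors.  In particular the choice of [w] is free, and it can be
    spent on keeping the sequence [good]. *)
Lemma greedy_hitting (W C T : finType) (A : {set T}) (kill : T -> W * C -> bool)
    (good : seq (W * C) -> Prop) (m l : nat) :
    0 < #|C| ->
    (forall t w, t \in A -> exists c, kill t (w, c)) ->
    good [::] ->
    (forall s, good s -> size s < m -> exists w, forall c, good ((w, c) :: s)) ->
    #|A| < 2 ^ l -> #|C| * l <= m ->
  exists s, good s /\ forall t, t \in A -> has (kill t) s.
Proof.
move=> C_gt0 killA good0 goodS ltA le_m.
pose alive s := [set t in A | ~~ has (kill t) s].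
have step i : i <= m -> exists s,
    [/\ good s, size s = i & #|alive s| * #|C| ^ i <= #|A| * #|C|.-1 ^ i].
  elim: i => [_|i IHi lt_im].
    exists [::]; split; rewrite // !expn0 !muln1.
    by apply/subset_leq_card/subsetP => t; rewrite inE => /andP[].
  have [s [good_s sz_s le_s]] := IHi (ltnW lt_im).
  have [w good_w] := goodS s good_s (leq_trans (eq_leq (congr1 S sz_s)) lt_im).
  (* Double counting of the pairs (t, c) such that [(w, c)] kills t. *)
  pose dead c := [set t in alive s | kill t (w, c)].
  have [c le_c] : exists c, #|alive s| <= #|C| * #|dead c|.
    apply/existsP; apply: contraT; rewrite negb_exists => /forallP few_dead.
    have {few_dead} few c : #|C| * #|dead c| < #|alive s|.
      by rewrite ltnNge few_dead.
    have : \sum_c #|dead c| >= #|alive s|.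
      apply: (@leq_trans #|\bigcup_c dead c|).
        apply/subset_leq_card/subsetP => t s_t.
        have At : t \in A by move: s_t; rewrite inE => /andP[].
        have [c kill_c] := killA t w At.
        by apply/bigcupP; exists c => //; rewrite inE s_t.
      elim/big_ind2: _ => [|B a B' a' leB leB'|//]; first by rewrite cards0.
      by apply: leq_trans (leq_card_setU _ _) _; rewrite leq_add.
    have : #|C| * (\sum_c #|dead c|) + #|C| <= #|C| * #|alive s|.
      rewrite big_distrr -sum_nat_const -[X in _ + X]sum1_card -big_split /=.
      by apply: leq_sum => c _; rewrite addn1 few.
    move=> le_q /(leq_mul (leqnn #|C|))/(leq_trans le_q).
    by rewrite -{2}[#|C| * _]addn0 leq_add2l leqNgt C_gt0.
  exists ((w, c) :: s); split; rewrite /= ?sz_s //.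
  have /eqP : #|alive ((w, c) :: s)| + #|dead c| == #|alive s|.
    rewrite -(cardsID (dead c) (alive s)) addnC; apply/eqP; congr (_ + _).
      by apply: eq_card => t; rewrite !inE andbA andbb.
    apply: eq_card => t; rewrite !inE /= negb_or.
    by case: (t \in A) => //=; case: (kill t _); case: (has _ s).
  move=> card_s; have le_y : #|alive ((w, c) :: s)| * #|C| <= #|alive s| * #|C|.-1.
    rewrite -card_s; move: le_c C_gt0; rewrite -card_s.
    by move: #|alive _| #|dead c| #|C| => y z q; nia.
  rewrite !expnS mulnA [#|A| * _]mulnCA.
  apply: leq_trans (leq_mul le_y (leqnn _)) _.
  by rewrite mulnAC mulnC leq_mul2l le_s orbT.
have [s [good_s _ le_s]] := step _ le_m; exists s; split=> // t At.
apply: contraTT le_s => s't; rewrite -ltnNge.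
have s_gt0 : 0 < #|alive s| by apply/card_gt0P; exists t; rewrite inE At.
have le_exp : 2 ^ l * #|C|.-1 ^ (#|C| * l) <= #|C| ^ (#|C| * l).
  rewrite 2!expnM -expnMn leq_expn2r //.
  by rewrite -(prednK C_gt0) double_expn_leq.
apply: leq_trans (leq_mul s_gt0 (leqnn _)); rewrite mul1n.
have [-> | X_gt0] := posnP (#|C|.-1 ^ (#|C| * l)).
  by rewrite muln0 expn_gt0 C_gt0.
by apply: leq_trans le_exp; rewrite ltn_pmul2r.
Qed.

(** The witness is itself a power of two, [2 ^ u]: the claim becomes an
    inequality between [2 ^ u] and a linear function of [u]. *)
Lemma poly_leq_exp2 (a b c k : nat) :
  exists m, a * (1 + b * m) ^ k <= 2 ^ m /\ c <= 2 ^ m.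
Proof.
pose A := a * b.+1 ^ k + c; pose v := A + 2 * k; pose u := 2 * v.
have lt_v : v < 2 ^ v by apply: ltn_expl.
have le_u : A + u * k <= 2 ^ u.
  rewrite /u mul2n -addnn expnD; have := leq_mul lt_v lt_v; rewrite /v; nia.
exists (2 ^ u).
have ltA : A < 2 ^ A by apply: ltn_expl.
split; last first.
  apply: (@leq_trans A); first exact: leq_addl.
  apply: leq_trans (ltnW ltA) _; rewrite leq_exp2l //; lia.
apply: (@leq_trans (2 ^ A * 2 ^ (u * k))); last by rewrite -expnD leq_exp2l.
have le_exp : (1 + b * 2 ^ u) ^ k <= b.+1 ^ k * 2 ^ (u * k).
  rewrite expnM -expnMn leq_expn2r // mulSn leq_add2r expn_gt0 //.
apply: leq_trans (leq_mul (leqnn a) le_exp) _; rewrite mulnA leq_mul2r.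
by apply/orP; right; apply: leq_trans (ltnW ltA); apply: leq_addr.
Qed.

(** Choose the [cc i] one after the other.  At each step at most [d] indices are
    excluded because they have no label, and at most [J] because their
    label occurs among the current values of [cc]. *)
Lemma transversal_exists (J N d : nat) (T : eqType) (f : 'I_J -> 'I_N -> option T) :
    (forall i, #|[set c | f i c == None]| <= d) ->
    (forall i c c', f i c = f i c' -> f i c != None -> c = c') ->
    d + J < N ->
  exists cc : {ffun 'I_J -> 'I_N},
    (forall i, f i (cc i) != None) /\ injective (fun i => f i (cc i)).
Proof.
move=> few_none f_inj lt_N.
suffices /(_ J (leqnn _)) [cc [ccN cc_inj]] : forall m, m <= J ->
    exists cc : {ffun 'I_J -> 'I_N},
      (forall i : 'I_J, i < m -> f i (cc i) != None) /\
      (forall i j : 'I_J, i < m -> j < m -> f i (cc i) = f j (cc j) -> i = j).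
  by exists cc; split=> [i | i j]; [apply: ccN | apply: cc_inj].
elim=> [_|m IHm lt_mJ].
  by exists [ffun=> Ordinal (leq_ltn_trans (leq0n _) lt_N)].
have [cc [ccN cc_inj]] := IHm (ltnW lt_mJ); pose i0 := Ordinal lt_mJ.
pose used := [seq f i (cc i) | i : 'I_J].
have sz_used : size used = J by rewrite size_map -cardE card_ord.
(* All current values are avoided, also those for the indices [i >= m] that will
   be replaced later; only their number matters. *)
have [c cN c'used] : exists2 c, f i0 c != None & f i0 c \notin used.
  apply/exists_inP; rewrite -negb_forall_in; apply/negP => /forall_inP all_used.
  have : #|[set c | f i0 c != None]| <= J.
    rewrite -sz_used cardE -(size_map (f i0)).
    apply: uniq_leq_size.
      rewrite map_inj_in_uniq ?enum_uniq // => c c'; rewrite mem_enum inE => cN _.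
      by move/f_inj; apply.
    by move=> _ /mapP[c + ->]; rewrite mem_enum inE => /all_used.
  have := few_none i0; have := cardsC [set c | f i0 c == None].
  rewrite card_ord (_ : ~: _ = [set c | f i0 c != None]).
    by lia.
  by apply/setP => c; rewrite !inE.
have lt_m (i : 'I_J) : i < m.+1 -> i != i0 -> i < m.
  rewrite ltnS ltn_neqAle => -> neq_i; rewrite andbT.
  by apply: contraNneq neq_i => eq_i; apply/eqP/val_inj.
exists [ffun i => if i == i0 then c else cc i]; split=> [i | i j].
  by rewrite ffunE => lt_i; case: (eqVneq i i0) => [-> // | /(lt_m i lt_i)/ccN].
have in_used i1 : f i1 (cc i1) \in used by apply: image_f.
move=> lt_i lt_j; rewrite !ffunE; case: (eqVneq i i0) => [-> | neq_i].
  case: (eqVneq j i0) => [-> // | neq_j] eq_f.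
  by rewrite eq_f in_used in c'used.
case: (eqVneq j i0) => [-> | neq_j] eq_f; last by apply: cc_inj; rewrite ?lt_m.
by rewrite -eq_f in_used in c'used.
Qed.

(** * Embeddings into the cube and its layers *)

Lemma cubical_of_toggles (G : sgraph) (C : finType) (pos : G -> C -> bool) :
    (forall u v, pos u =1 pos v -> u = v) ->
    (forall u v, adj u v -> exists e, forall x, (pos u x != pos v x) = (x == e)) ->
  cubical G.
Proof.
move=> pos_inj pos_adj; exists #|C|.
exists (fun u => [ffun i => pos u (enum_val i)]); split=> [u v /ffunP eq_uv | u v].
  by apply: pos_inj => x; have := eq_uv (enum_rank x); rewrite !ffunE enum_rankK.
case/pos_adj=> e toggle_e; apply/cards1P; exists (enum_rank e).
apply/setP => i; rewrite !inE !ffunE toggle_e.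
by rewrite -(inj_eq enum_val_inj) enum_rankK.
Qed.

Lemma toggle_on (T : eqType) (x y : T) : (false != (x == y)) = (y == x).
Proof. by rewrite [RHS]eq_sym; case: (x == y). Qed.

Lemma toggle_off (T : eqType) (x y : T) : ((x == y) != false) = (y == x).
Proof. by rewrite [RHS]eq_sym; case: (x == y). Qed.

Section Layer.

Variables m h : nat.
Implicit Types x y z : {ffun 'I_m -> bool}.

Definition hdist x y : nat := #|[set i | x i != y i]|.

Lemma hdistC x y : hdist x y = hdist y x.
Proof. by apply: eq_card => i; rewrite !inE eq_sym. Qed.

Lemma hdist_triangle y x z : hdist x z <= hdist x y + hdist y z.
Proof.
apply: leq_trans (leq_card_setU _ _); apply/subset_leq_card/subsetP => i.
by rewrite !inE; case: (x i); case: (y i); case: (z i).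
Qed.

Definition in_layer x : bool := (ones x == h) || (ones x == h.+1).

Definition upper x : bool := ones x == h.+1.

(** A vertex is [upper] if it is in the upper half of the layer.  Along an edge
    the coordinate that changes goes from 1 to 0 when one leaves an upper
    vertex, and from 0 to 1 otherwise; thus in [x] it has the value [upper x]. *)
Lemma layer_edge x y : in_layer x -> in_layer y -> cube_adj x y ->
  upper y = ~~ upper x /\
  exists e, [/\ x e = upper x, y e = ~~ upper x & forall i, i != e -> y i = x i].
Proof.
rewrite /in_layer /upper => lx ly /cards1P[e /setP def_e].
have eq_xy i : i != e -> y i = x i.
  by have := def_e i; rewrite !inE => /esym; case: eqVneq => // _ /esym/negPn/eqP->.
have neq_e : y e = ~~ x e.
  by have := def_e e; rewrite !inE eqxx; case: (x e); case: (y e).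
have onesE u : ones u = u e + #|[set i | u i] :\ e| by rewrite /ones (cardsD1 e) inE.
have eq_r : [set i | x i] :\ e = [set i | y i] :\ e.
  by apply/setP => i; rewrite !inE; case: eqVneq => //= /eq_xy->.
move: lx ly; rewrite (onesE x) (onesE y) -eq_r.
move: #|_| => r; case def_x: (x e) neq_e => /= def_y lx ly;
  have -> : r = h by lia.
all: by split; [lia | exists e; rewrite def_x def_y; split=> //; lia].
Qed.

(** The second step changes a coordinate other than [e], since otherwise it would
    lead back to [x0]; the third step has the orientation of the first one, so
    it cannot restore [e] either. *)
Lemma layer_path3 x0 x1 x2 x3 e :
    in_layer x0 -> in_layer x1 -> in_layer x2 -> in_layer x3 ->
    cube_adj x0 x1 -> cube_adj x1 x2 -> cube_adj x2 x3 -> x2 <> x0 ->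
    x0 e != x1 e ->
  x3 e = ~~ x0 e.
Proof.
move=> l0 l1 l2 l3 e01 e12 e23 neq_x20 neq_e.
have [up1 [i [x0i x1i eq_01]]] := layer_edge l0 l1 e01.
have [up2 [j [x1j x2j eq_12]]] := layer_edge l1 l2 e12.
have [_ [r [x2r x3r eq_23]]] := layer_edge l2 l3 e23.
have def_e : e = i by apply: contraNeq neq_e => /eq_01->.
have neq_ij : i != j.
  apply/eqP => eq_ij; case: neq_x20; apply/ffunP => t.
  have [-> | neq_t] := eqVneq t i; first by rewrite {1}eq_ij x2j x0i up1 negbK.
  by rewrite eq_12 -?eq_ij // eq_01.
have x2i : x2 i = ~~ upper x0 by rewrite eq_12 // x1i.
have neq_ir : i != r.
  by apply: contraFneq (erefl false) => eq_ir; move: x2i x2r;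
     rewrite -eq_ir up2 up1 => ->; case: upper.
by rewrite def_e eq_23 // x2i x0i.
Qed.

(** With [X] and [Z] the sets of ones of [x] and [z], whose sizes differ by 1,
    the sizes of X minus Z and of Z minus X differ by 1 as well, and the Hamming
    distance is their sum. *)
Lemma opposite_sides x z : in_layer x -> in_layer z -> upper z = ~~ upper x ->
  2 * #|[set i | (x i == upper x) && (z i != upper x)]| <= (hdist x z).+1.
Proof.
rewrite /in_layer /hdist => lx lz up_z.
set X := [set i | x i]; set Z := [set i | z i].
have -> : [set i | x i != z i] = (X :\: Z) :|: (Z :\: X).
  by apply/setP => i; rewrite !inE; case: (x i); case: (z i).
rewrite cardsU (_ : _ :&: _ = set0) ?cards0 ?subn0; last first.
  by apply/setP => i; rewrite !inE; case: (x i); case: (z i).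
have -> : [set i | (x i == upper x) && (z i != upper x)] =
          if upper x then X :\: Z else Z :\: X.
  by apply/setP => i; case: (upper x); rewrite !inE; case: (x i); case: (z i).
have := cardsID Z X; have := cardsID X Z; rewrite setIC.
move: up_z lx lz; rewrite /upper /ones -/X -/Z.
by case: (#|X| =P h.+1) => /= *; lia.
Qed.

End Layer.

(** * The gadget graphs *)

Section Graph.

Variables J n N : nat.

Definition word : finType := {ffun 'I_J -> 'I_n}.
(** A word with one letter erased: the position of this letter, and the
    remaining letters in order. *)
Definition facet : finType := ('I_J * {ffun 'I_J.-1 -> 'I_n})%type.
Definition gadget : finType := (word * {ffun 'I_J -> 'I_N})%type.

Definition erase (w : word) (i : 'I_J) : facet :=
  (i, [ffun u => w (lift i u)]).

Lemma erase_pair_inj (w w' : word) (i j : 'I_J) :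
  i != j -> erase w i = erase w' i -> erase w j = erase w' j -> w = w'.
Proof.
move=> neq_ij [/ffunP eq_i] [/ffunP eq_j]; apply/ffunP => t.
have [u ->|->] := unliftP i t; first by have := eq_i u; rewrite !ffunE.
have [u -> | eq_ij] := unliftP j i; first by have := eq_j u; rewrite !ffunE.
by rewrite eq_ij eqxx in neq_ij.
Qed.

(** The tails [Tail b 0], ..., [Tail b J.-1] are the interior vertices of the path
    from the apex to the hub of [b].  The vertex [Arm w i c] hangs on the leaf [c]
    of the [i]-th facet of [w]; arms are there for all words and all [c], so that
    the vertex set does not depend on the gadgets. *)
Inductive vertex :=
  | Apex
  | Tail of facet & 'I_J
  | Hub of facet
  | Leaf of facet & 'I_N
  | Arm of word & 'I_J & 'I_N
  | Center of word.

Definition vertex_code (v : vertex) :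
    unit + facet * 'I_J + facet + facet * 'I_N + word * 'I_J * 'I_N + word :=
  match v with
  | Apex => inl (inl (inl (inl (inl tt))))
  | Tail b t => inl (inl (inl (inl (inr (b, t)))))
  | Hub b => inl (inl (inl (inr b)))
  | Leaf b c => inl (inl (inr (b, c)))
  | Arm w i c => inl (inr (w, i, c))
  | Center w => inr w
  end.

Definition vertex_decode x : vertex :=
  match x with
  | inl (inl (inl (inl (inl tt)))) => Apex
  | inl (inl (inl (inl (inr (b, t))))) => Tail b t
  | inl (inl (inl (inr b))) => Hub b
  | inl (inl (inr (b, c))) => Leaf b c
  | inl (inr (w, i, c)) => Arm w i c
  | inr w => Center w
  end.

Lemma vertex_codeK : cancel vertex_code vertex_decode.
Proof. by case. Qed.

HB.instance Definition _ := Finite.copy vertex (can_type vertex_codeK).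

Implicit Types (s : seq gadget) (b : facet) (w : word) (u v : vertex).

(** One orientation of each edge.  The flag [apx] tells whether the apex is
    connected to the tails: without these edges, the graph without
    gadgets is a forest whose components correspond to the facets. *)
Definition link (apx : bool) s u v : bool :=
  match u, v with
  | Apex, Tail _ t => apx && (t == 0 :> nat)
  | Tail b t, Tail b' t' => (b == b') && (t' == t.+1 :> nat)
  | Tail b t, Hub b' => (b == b') && (t.+1 == J)
  | Leaf b _, Hub b' => b == b'
  | Arm w i c, Leaf b c' => (b == erase w i) && (c == c')
  | Center w, Arm w' i c =>
      (w == w') && has (fun g : gadget => (g.1 == w) && (g.2 i == c)) s
  | _, _ => false
  end.

Definition edge apx s : rel vertex := fun u v => link apx s u v || link apx s v u.

Lemma edge_sym apx s : symmetric (edge apx s).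
Proof. by move=> u v; rewrite /edge orbC. Qed.

Lemma edge_irr apx s : irreflexive (edge apx s).
Proof. by case=> //= b t; rewrite /edge /= orbb eqxx /= ltn_eqF. Qed.

Definition gadget_graph s : sgraph :=
  SGraph (edge_sym true s) (edge_irr true s).

Definition height v : nat :=
  match v with
  | Tail _ t => J - t
  | Leaf _ _ => 1
  | Arm _ _ _ => 2
  | _ => 0
  end.

(** The trees of this forest are rooted at the hubs. *)
Lemma cycles_ge_nil k : cycles_ge k (edge false [::]).
Proof.
apply: (@cycles_ge_height _ height); first exact: edge_sym.
case=> [|b t|b|b c|w i c|w] [|b1 t1|b1|b1 c1|w1 i1 c1|w1]
  [|b2 t2|b2|b2 c2|w2 i2 c2|w2] //=; rewrite /edge /= ?andbF ?orbF //.
all: try (have := ltn_ord t); try (have := ltn_ord t1); try (have := ltn_ord t2).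
- move=> lt2 lt1 lt0 /orP[] /andP[/eqP eb1 /eqP et1];
    move=> /orP[] /andP[/eqP eb2 /eqP et2] le1 le2; try lia.
  by rewrite -eb1 eb2; congr Tail; apply: val_inj; rewrite /= et1.
- by move=> lt1 lt0 /orP[] /andP[_ /eqP et1] /andP[_ /eqP et2]; lia.
- by move=> lt2 lt0 /andP[_ /eqP et1] /orP[] /andP[_ /eqP et2]; lia.
- by move=> _ /andP[/eqP-> _] /andP[/eqP-> _].
- by move=> lt2 lt1 _ _; lia.
- by move=> /eqP-> /eqP->.
by case/andP=> /eqP-> /eqP<- /andP[/eqP-> /eqP<-].
Qed.

(** * Words with remote facets *)

(** The first component of a facet tells which letter of the word is to be erased. *)
Definition incident b w : bool := erase w b.1 == b.

Lemma incident_erase w i : incident (erase w i) w.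
Proof. exact: eqxx. Qed.

Lemma incidentP b w : reflect (exists i, b = erase w i) (incident b w).
Proof.
by apply: (iffP eqP) => [<-|[i ->]]; [exists b.1 | ].
Qed.

Definition degree s b : nat := count (fun g : gadget => incident b g.1) s.

Definition near s b b' : bool :=
  (b == b') || has (fun g : gadget => incident b g.1 && incident b' g.1) s.

Fixpoint ball s r b : {set facet} :=
  if r is r'.+1 then \bigcup_(b1 in ball s r' b) [set b2 | near s b1 b2]
  else [set b].

Lemma ball_subS s r b : ball s r b \subset ball s r.+1 b.
Proof.
apply/subsetP => b1 b_b1; apply/bigcupP; exists b1 => //.
by rewrite inE /near eqxx.
Qed.

Lemma ball_sub s r r' b : r <= r' -> ball s r b \subset ball s r' b.
Proof.
move/subnK <-; elim: (r' - r) => // d IHd.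
exact: subset_trans IHd (ball_subS _ _ _).
Qed.

Lemma card_incident_facets w : #|[set b | incident b w]| <= J.
Proof.
rewrite -[leqRHS]card_ord -cardsT; apply: leq_trans (leq_imset_card (erase w) _).
apply/subset_leq_card/subsetP => b; rewrite inE => /incidentP[i ->].
by rewrite imset_f ?inE.
Qed.

Lemma card_incident_words b : #|[set w | incident b w]| <= n.
Proof.
rewrite -[leqRHS]card_ord.
apply: (@leq_card_in _ _ (fun w : word => w b.1)) => w w'.
rewrite !inE /incident => /eqP bw /eqP bw' eq_b; apply/ffunP => t.
have [u -> | -> //] := unliftP b.1 t.
have /(congr1 snd)/ffunP/(_ u) : erase w b.1 = erase w' b.1 by rewrite bw.
by rewrite !ffunE.
Qed.

Lemma card_near s b : #|[set b' | near s b b']| <= 1 + J * degree s b.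
Proof.
elim: s => [|g s IHs].
  rewrite muln0 addn0 -(cards1 b); apply/subset_leq_card/subsetP => b'.
  by rewrite !inE /near orbF eq_sym.
rewrite /degree /= mulnDr addnCA.
have [bg | b'g] := boolP (incident b g.1); last first.
  rewrite muln0; apply: leq_trans _ IHs; apply/subset_leq_card/subsetP => b'.
  by rewrite !inE /near /= (negPf b'g).
rewrite muln1; apply: leq_trans (leq_add (card_incident_facets g.1) IHs).
apply: leq_trans _ (leq_card_setU _ _); apply/subset_leq_card/subsetP => b'.
by rewrite !inE /near /= bg /= => /orP[-> | /orP[-> | ->]]; rewrite ?orbT.
Qed.

Lemma card_ball s r b (d : nat) :
  (forall b', degree s b' <= d) -> #|ball s r b| <= (1 + J * d) ^ r.
Proof.
move=> le_d; elim: r => [|r IHr] /=; first by rewrite cards1.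
rewrite expnSr; apply: leq_trans (leq_mul IHr (leqnn _)).
apply: leq_card_bigcup => b1 _; apply: leq_trans (card_near _ _) _.
by rewrite leq_add2l leq_mul2l le_d orbT.
Qed.

Lemma sum_degree s : \sum_b degree s b <= J * size s.
Proof.
elim: s => [|g s IHs]; first by rewrite big1.
rewrite /degree /= big_split /= mulnS leq_add //.
apply: leq_trans (card_incident_facets g.1).
by rewrite -sum1dep_card [leqRHS]big_mkcond leq_sum // => b _; case: incident.
Qed.

Lemma card_facet : #|facet| = J * n ^ J.-1.
Proof. by rewrite card_prod card_ffun !card_ord. Qed.

(** Few facets have degree [d], as the average degree is small, and each of them
    lies in at most [n] words.  Few pairs of facets are close, as degrees are
    bounded, and a word is determined by any two of its facets.  The two
    numerical hypotheses say that each of the two obstructions concerns at most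
    half of the words. *)
Lemma exists_remote_word s (k d : nat) :
    (forall b, degree s b <= d) ->
    2 * (n * (J * size s)) < d * n ^ J ->
    2 * (J * n ^ J.-1 * (1 + J * d) ^ k) <= n ^ J ->
  exists w, (forall i, degree s (erase w i) < d) /\
    (forall i j, i != j -> erase w j \notin ball s k (erase w i)).
Proof.
move=> le_d few_sat few_near.
pose sat := \bigcup_(b | d <= degree s b) [set w | incident b w].
pose close := \bigcup_b \bigcup_(b' | (b.1 != b'.1) && (b' \in ball s k b))
  [set w | incident b w && incident b' w].
have card_sat : 2 * #|sat| < n ^ J.
  have card_sat1 : #|sat| <= #|[pred b | d <= degree s b]| * n.
    by apply: leq_card_bigcup => b _; apply: card_incident_words.
  have sum_sat : #|[pred b | d <= degree s b]| * d <= J * size s.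
    apply: leq_trans (sum_degree s); rewrite -sum_nat_const big_mkcond /=.
    by apply: leq_sum => b _; rewrite inE; case: ifP.
  by move: few_sat card_sat1 sum_sat; set x := #|sat|; set y := #|_|;
    move: (J * size s) (n ^ J) => *; nia.
have card_close : 2 * #|close| <= n ^ J.
  apply: leq_trans few_near; rewrite leq_mul2l /= -card_facet.
  apply: leq_card_bigcup => b _; apply: leq_trans (card_ball k b le_d).
  apply: (@leq_trans (#|[pred b' | (b.1 != b'.1) && (b' \in ball s k b)]| * 1)).
    apply: leq_card_bigcup => b' /andP[neq_bb _].
    apply/card_le1_eqP => w w'; rewrite !inE.
    move=> /andP[/eqP w1 /eqP w2] /andP[/eqP w'1 /eqP w'2].
    by apply: (erase_pair_inj neq_bb); rewrite ?w1 ?w2.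
  by rewrite muln1; apply/subset_leq_card/subsetP => b'; rewrite inE => /andP[].
have [w] : exists w, w \notin sat :|: close.
  apply/existsP; rewrite -negb_forall; apply/negP => /forallP all_w.
  have : #|word| <= #|sat :|: close| by apply/subset_leq_card/subsetP => w _.
  rewrite card_ffun !card_ord; apply/negP; rewrite -ltnNge.
  by apply: leq_ltn_trans (leq_card_setU _ _) _; lia.
rewrite inE negb_or => /andP[w'sat w'close]; exists w; split=> [i | i j neq_ij].
  rewrite ltnNge; apply: contra w'sat => sat_i; apply/bigcupP.
  by exists (erase w i); rewrite // inE incident_erase.
apply: contra w'close => close_ij; apply/bigcupP; exists (erase w i) => //.
apply/bigcupP; exists (erase w j); first by rewrite /= neq_ij.
by rewrite inE !incident_erase.
Qed.

(** * Adding gadgets and the apex without creating short cycles *)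

(** The facets to which a vertex is attached; a path in the graph of gadgets
    projects through them to a path in the incidence graph of facets and
    words. *)
Definition region v : {set facet} :=
  match v with
  | Apex => set0
  | Tail b _ | Hub b | Leaf b _ => [set b]
  | Arm w i _ => [set erase w i]
  | Center w => [set b | incident b w]
  end.

Lemma region_edge s u v b' :
  edge false s u v -> b' \in region v -> exists2 b, b \in region u & near s b b'.
Proof.
have near_refl b : near s b b by rewrite /near eqxx.
have center w i g : g \in s -> g.1 == w -> incident b' w -> near s (erase w i) b'.
  move=> sg /eqP gw b'w; apply/orP; right; apply/hasP; exists g => //.
  by rewrite gw incident_erase.
case: u v => [|b t|b|b c|w i c|w] [|b1 t1|b1|b1 c1|w1 i1 c1|w1] //=;
  rewrite /edge /= ?orbF ?inE //.
- by move=> /orP[] /andP[/eqP-> _] /eqP->; eexists; rewrite ?inE.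
- by move=> /andP[/eqP-> _] /eqP->; eexists; rewrite ?inE.
- by move=> /andP[/eqP-> _] /eqP->; eexists; rewrite ?inE.
- by move=> /eqP-> /eqP->; eexists; rewrite ?inE.
- by move=> /eqP-> /eqP->; eexists; rewrite ?inE.
- by move=> /andP[/eqP-> _] /eqP->; eexists; rewrite ?inE.
- by move=> /andP[/eqP-> _] /eqP->; eexists; rewrite ?inE.
- case/andP=> /eqP-> /hasP[g sg /andP[gw _]] b'w.
  by exists (erase w i); rewrite ?inE //; apply: center sg gw b'w.
- by case/andP=> /eqP-> _ /eqP->; exists (erase w1 i1); rewrite // inE incident_erase.
Qed.

Lemma region_path s b u p :
    region u = [set b] -> path (edge false s) u p ->
  region (last u p) \subset ball s (size p) b.
Proof.
move=> u_b; elim/last_ind: p => [|p v IHp]; first by rewrite /= u_b.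
rewrite rcons_path last_rcons size_rcons => /andP[/IHp/subsetP sub_p uv].
apply/subsetP => b' v_b'; have [b1 /sub_p p_b1 near_b1] := region_edge uv v_b'.
by apply/bigcupP; exists b1; rewrite ?inE.
Qed.

(** The center of [w] is a new vertex, whose neighbours are attached to
    the facets of [w]; a path joining two of them projects to the incidence graph,
    where these facets are far apart. *)
Lemma cycles_ge_cons s k (w : word) (cc : {ffun 'I_J -> 'I_N}) :
    0 < k -> 1 < J -> cycles_ge k (edge false s) ->
    (forall i j, i != j -> erase w j \notin ball s k (erase w i)) ->
  cycles_ge k (edge false ((w, cc) :: s)).
Proof.
move=> k_gt0 J_gt1 girth_s far.
(* Facets of a word of [s] are at distance 1 from each other, so [w] is not
   among these words. *)
have s'w g : g \in s -> g.1 != w.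
  move=> sg; apply: contraL (far (Ordinal (ltnW J_gt1)) (Ordinal J_gt1) isT).
  move=> /eqP gw; rewrite negbK; apply: subsetP (ball_sub _ _ k_gt0) _ _.
  apply/bigcupP; exists (erase w (Ordinal (ltnW J_gt1))); rewrite ?inE //.
  by apply/orP; right; apply/hasP; exists g => //; rewrite gw !incident_erase.
have link_s x y : x != Center w ->
    link false ((w, cc) :: s) x y -> link false s x y.
  case: x y => [|b t|b|b c|w1 i1 c1|w1] [|b1 t1|b1|b1 c2|w2 i2 c2|w2] //= w1w.
  by rewrite (_ : w == w1 = false) //=; apply: contraNF w1w => /eqP->.
have nbr z : edge false ((w, cc) :: s) (Center w) z -> exists i, z = Arm w i (cc i).
  case: z => [|b t|b|b c|w1 i1 c1|w1] //=; rewrite /edge /= ?orbF //.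
  case/andP=> /eqP<- /orP[/andP[_ /eqP<-] | /hasP[g sg /andP[]]]; first by exists i1.
  by rewrite (negPf (s'w g sg)).
apply: (cycles_ge_add_vertex (v := Center w) (edge_sym _ _) _ girth_s).
  by move=> x y xw yw /orP[] /link_s xy; rewrite /edge xy ?orbT.
move=> z p /nbr[i def_z] /nbr[j def_z'] neq_z z_p; rewrite leqNgt.
apply/negP => lt_pk.
have neq_ij : i != j.
  by apply: contraNneq neq_z => eq_ij; rewrite def_z' def_z eq_ij.
have /negP[] := far i j neq_ij; apply: subsetP (ball_sub _ _ (ltnW lt_pk)) _ _.
have /region_path/(_ z_p)/subsetP sub_p : region z = [set erase w i] by rewrite def_z.
by apply: sub_p; rewrite def_z' inE.
Qed.

Lemma path_from_tail s b (t : 'I_J) p :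
    t = 0 :> nat -> path (edge false s) (Tail b t) p -> size p < J ->
  exists2 t' : 'I_J, last (Tail b t) p = Tail b t' & t' <= size p.
Proof.
move=> t0; elim/last_ind: p => [|p v IHp]; first by exists t; rewrite ?t0.
rewrite rcons_path last_rcons size_rcons => /andP[/IHp{}IHp] + lt_p.
have [t1 -> le_t1] := IHp (ltnW lt_p).
case: v => [|b2 t2|b2|b2 c2|w2 i2 c2|w2] //=; rewrite /edge /= ?orbF //.
  by move=> /orP[] /andP[/eqP-> /eqP eq_t]; exists t2 => //; lia.
by case/andP=> _ /eqP eq_t; lia.
Qed.

(** Two neighbours of the apex are the ends of different tails, and any path
    between them has to run along a whole tail. *)
Lemma cycles_ge_apex s k :
  k <= J -> cycles_ge k (edge false s) -> cycles_ge k (edge true s).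
Proof.
move=> le_kJ girth_s.
apply: (cycles_ge_add_vertex (v := Apex) (edge_sym _ _) _ girth_s).
  by move=> [|b t|b|b c|w i c|w] [|b1 t1|b1|b1 c1|w1 i1 c1|w1].
have nbr z : edge true s Apex z -> exists b (t : 'I_J), z = Tail b t /\ t = 0 :> nat.
  case: z => [|b t|b|b c|w i c|w] //; rewrite /edge /= orbF => /eqP t0.
  by exists b, t.
move=> z p /nbr[b [t [-> t0]]] /nbr[b' [t' [def_z' t'0]]] neq_z z_p.
rewrite leqNgt; apply/negP => lt_pk.
have [t1 def_t1 _] := path_from_tail t0 z_p (leq_trans lt_pk le_kJ).
case/eqP: neq_z; rewrite def_z'; move: def_z'; rewrite def_t1 => -[-> eq_t].
by congr Tail; apply: val_inj; rewrite /= t0 t'0.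
Qed.

(** * Gadgets hitting all labellings *)

(** The label of [(b, c)] stands for the coordinate in which an embedding separates
    the hub of [b] from its leaf [c], and [None] means that this coordinate is
    useless because the apex and the hub disagree there.  As only equality of
    coordinates matters, pairs (facet, leaf index) serve as labels; this
    makes the number of labellings independent of the cube. *)
Definition labelling : finType := {ffun facet * 'I_N -> option (facet * 'I_N)}.

(** What labellings coming from embeddings satisfy: the distance from the apex to a
    hub bounds the number of useless coordinates, and different leaves of a hub
    use different coordinates. *)
Definition proper_labelling (th : labelling) : bool :=
  [forall b, (#|[set c | th (b, c) == None]| <= J.+1) &&
    [forall c, forall c',
      (th (b, c) == th (b, c')) && (th (b, c) != None) ==> (c == c')]].

Definition rainbow (th : labelling) (g : gadget) : bool :=
  [forall i, th (erase g.1 i, g.2 i) != None] &&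
  injectiveb (fun i => th (erase g.1 i, g.2 i)).

(** Degrees are kept at most [d] while at most [N ^ J * l] gadgets are chosen: there
    are [N ^ J] choices of leaf indices for a word, and fewer than [2 ^ l]
    labellings, so this number of steps kills them all. *)
Lemma exists_rainbow_gadgets (k d l : nat) :
    0 < k <= J -> 1 < J -> 2 * J.+1 <= N ->
    (#|facet| * N).+1 ^ (#|facet| * N) < 2 ^ l ->
    2 * (n * (J * (N ^ J * l))) <= d * n ^ J ->
    2 * (J * n ^ J.-1 * (1 + J * d) ^ k) <= n ^ J ->
    0 < n ->
  exists s, cycles_ge k (edge true s) /\
    forall th, proper_labelling th -> has (rainbow th) s.
Proof.
move=> /andP[k_gt0 le_kJ] J_gt1 le_N lt_l le_d few_near n_gt0.
pose good s := cycles_ge k (edge false s) /\ forall b, degree s b <= d.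
have [|||s gs lt_s|||s [[girth_s _] hit_s]] :=
    @greedy_hitting word {ffun 'I_J -> 'I_N} labelling [set th | proper_labelling th]
      rainbow good (N ^ J * l) l.
- by rewrite card_ffun !card_ord expn_gt0; lia.
- move=> th w; rewrite inE => /forallP th_ok.
  have [|i c c' eq_c cN||cc [ccN cc_inj]] :=
      @transversal_exists J N J.+1 _ (fun i c => th (erase w i, c)).
  + by move=> i; case/andP: (th_ok (erase w i)).
  + have /andP[_ /forallP/(_ c)/forallP/(_ c')/implyP th_inj] := th_ok (erase w i).
    by apply/eqP/th_inj; rewrite eq_c eqxx -eq_c.
  + by lia.
  exists cc; apply/andP; split; first exact/forallP.
  exact/injectiveP.
- by split=> //; apply: cycles_ge_nil.
- have [girth_s le_deg] := gs.
  have [|w [deg_w far_w]] := exists_remote_word le_deg _ few_near.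
    apply: leq_trans le_d; rewrite !ltn_pmul2l //; lia.
  exists w => cc; split=> [|b]; first exact: cycles_ge_cons.
  rewrite /degree /=; case: (boolP (incident b w)) => [/incidentP[i ->] | _].
    exact: deg_w.
  exact: le_deg.
- apply: leq_ltn_trans lt_l; apply: leq_trans (max_card _) _.
  by rewrite card_ffun card_option card_prod card_ord.
- by rewrite card_ffun !card_ord.
exists s; split; first exact: cycles_ge_apex.
by move=> th th_ok; apply: hit_s; rewrite inE.
Qed.

(** * Gadget graphs are cubical *)

(** There is a coordinate for each letter at each position, for each type of leaf,
    and for each facet; the last ones keep the tails apart. *)
Definition coord : finType := ('I_J * 'I_n + 'I_J * 'I_N + facet)%type.

(** The first [m] letters of the facet [b], each with its position in the word; all
    its letters when [m >= J.-1], in particular when [m = J]. *)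
Definition prefix b (m : nat) (x : 'I_J * 'I_n) : bool :=
  if unlift b.1 x.1 is Some u then (u < m) && (b.2 u == x.2) else false.

Definition position v (x : coord) : bool :=
  match v, x with
  | Tail b t, inl (inl y) => prefix b t y
  | Tail b _, inr b' => b == b'
  | Hub b, inl (inl y) => prefix b J y
  | Leaf b c, inl (inl y) => prefix b J y
  | Leaf b c, inl (inr y) => (b.1, c) == y
  | Arm w i c, inl (inl y) => w y.1 == y.2
  | Arm w i c, inl (inr y) => (i, c) == y
  | Center w, inl (inl y) => w y.1 == y.2
  | _, _ => false
  end.

Lemma prefix_lift b m (u : 'I_J.-1) a : prefix b m (lift b.1 u, a) = (u < m) && (b.2 u == a).
Proof. by rewrite /prefix /= liftK. Qed.

Lemma prefix_missing b m a : prefix b m (b.1, a) = false.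
Proof. by rewrite /prefix /= unlift_none. Qed.

Lemma prefix_full b (u : 'I_J.-1) : prefix b J (lift b.1 u, b.2 u).
Proof. by rewrite prefix_lift eqxx andbT; have := ltn_ord u; lia. Qed.

Lemma prefix_inj b b' : prefix b J =1 prefix b' J -> b = b'.
Proof.
move=> eq_p; have eq1 : b.1 = b'.1.
  have [u def_b' | //] := unliftP b.1 b'.1.
  by have := prefix_full b u; rewrite -def_b' eq_p prefix_missing.
case: b b' eq1 eq_p => [i g] [i' g'] /= <- eq_p; congr (_, _); apply/ffunP => u.
have := prefix_full (i, g) u; rewrite eq_p prefix_lift /=.
by case/andP=> _ /eqP.
Qed.

Lemma position_inj u v : 1 < J -> position u =1 position v -> u = v.
Proof.
move=> J_gt1.
have row_inj (w w' : word) :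
    (forall y : 'I_J * 'I_n, (w y.1 == y.2) = (w' y.1 == y.2)) -> w = w'.
  by move=> eq_w; apply/ffunP => l; apply/esym/eqP; rewrite -(eq_w (l, w l)) eqxx.
pose l0 := Ordinal (ltnW J_gt1).
have u0 : 'I_J.-1 by apply: (@Ordinal _ 0); lia.
case: u v => [|b t|b|b c|w i c|w] [|b1 t1|b1|b1 c1|w1 i1 c1|w1] // eq_uv.
all: try by have := eq_uv (inr b); rewrite /= eqxx.
all: try by have := eq_uv (inr b1); rewrite /= eqxx.
all: try by have := eq_uv (inl (inr (b.1, c))); rewrite /= eqxx.
all: try by have := eq_uv (inl (inr (b1.1, c1))); rewrite /= eqxx.
all: try by have := eq_uv (inl (inr (i, c))); rewrite /= eqxx.
all: try by have := eq_uv (inl (inr (i1, c1))); rewrite /= eqxx.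
all: try by have := eq_uv (inl (inl (b.1, w1 b.1))); rewrite /= prefix_missing eqxx.
all: try by have := eq_uv (inl (inl (b1.1, w b1.1))); rewrite /= prefix_missing eqxx.
all: try by have := eq_uv (inl (inl (l0, w l0))); rewrite /= eqxx.
all: try by have := eq_uv (inl (inl (l0, w1 l0))); rewrite /= eqxx.
all: try by have := eq_uv (inl (inl (lift b.1 u0, b.2 u0))); rewrite /= prefix_full.
all: try by have := eq_uv (inl (inl (lift b1.1 u0, b1.2 u0))); rewrite /= prefix_full.
- have := eq_uv (inr b); rewrite /= eqxx => /esym/eqP def_b.
  subst b1; congr Tail; apply: val_inj; apply/eqP.
  have not_lt (t2 t3 : 'I_J) : prefix b t2 =1 prefix b t3 -> ~~ (t2 < t3).
    move=> eq_t; apply/negP => lt_t; have lt_t1 : t2 < J.-1 by have := ltn_ord t3; lia.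
    have := eq_t (lift b.1 (Ordinal lt_t1), b.2 (Ordinal lt_t1)).
    by rewrite !prefix_lift /= ltnn eqxx lt_t.
  rewrite eqn_leq; apply/andP; split; rewrite leqNgt; apply: not_lt => y.
    by have := eq_uv (inl (inl y)).
  by have := eq_uv (inl (inl y)).
- by congr Hub; apply: prefix_inj => y; apply: (eq_uv (inl (inl y))).
- have := eq_uv (inl (inr (b.1, c))); rewrite /= eqxx => /esym/eqP[_ <-].
  by congr Leaf; apply: prefix_inj => y; apply: (eq_uv (inl (inl y))).
- have := eq_uv (inl (inr (i, c))); rewrite /= eqxx => /esym/eqP[<- <-].
  by congr Arm; apply: row_inj => y; apply: (eq_uv (inl (inl y))).
- by congr Center; apply: row_inj => y; apply: (eq_uv (inl (inl y))).
Qed.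

Lemma position_link s u v : link true s u v ->
  exists e, forall x, (position u x != position v x) = (x == e).
Proof.
case: u v => [|b t|b|b c|w i c|w] [|b1 t1|b1|b1 c1|w1 i1 c1|w1] //=.
- move=> /eqP t0; exists (inr b1) => -[[[l a]|y]|b'] //=.
    by rewrite /prefix /= t0; case: unlift.
  by rewrite ?toggle_on ?toggle_off.
- case/andP=> /eqP<- /eqP def_t1; have lt_t : t < J.-1 by have := ltn_ord t1; lia.
  exists (inl (inl (lift b.1 (Ordinal lt_t), b.2 (Ordinal lt_t)))).
  case=> [[[l a]|y]|b'] /=; rewrite ?eqxx //.
  rewrite [RHS](_ : _ = ((l, a) == (lift b.1 (Ordinal lt_t), b.2 (Ordinal lt_t)))) //.
  have [h -> | ->] := unliftP b.1 l.
    rewrite !prefix_lift def_t1 ltnS xpair_eqE (inj_eq lift_inj).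
    rewrite (_ : (h == _) = (h == t :> nat)) //.
    rewrite [a == _]eq_sym; case: (ltngtP h t) => //= [_ | eq_ht]; first by rewrite eqxx.
    have -> : Ordinal lt_t = h by apply/ord_inj.
    by case: (_ == a).
  by rewrite !prefix_missing xpair_eqE (negPf (neq_lift _ _)).
- case/andP=> /eqP<- /eqP def_J; exists (inr b) => -[[[l a]|y]|b'] //=.
    have [h -> | ->] := unliftP b.1 l; last by rewrite !prefix_missing.
    have lt_h := ltn_ord h; rewrite !prefix_lift.
    have [-> ->] : (h < t) /\ (h < J) by split; lia.
    by rewrite eqxx.
  by rewrite ?toggle_on ?toggle_off.
- move=> /eqP->; exists (inl (inr (b1.1, c))) => -[[[l a]|y]|b'] //=.
    by rewrite eqxx.
  by rewrite ?toggle_on ?toggle_off.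
- case/andP=> /eqP-> /eqP->; exists (inl (inl (i, w i))).
  case=> [[[l a]|y]|b'] /=; rewrite ?eqxx //.
  rewrite [RHS](_ : _ = ((l, a) == (i, w i))) // xpair_eqE.
  have [h -> | ->] := unliftP i l; last first.
    by rewrite (prefix_missing (erase w i)) eqxx toggle_off.
  rewrite (prefix_lift (erase w i)) ffunE [lift i h == i]eq_sym (negPf (neq_lift _ _)).
  by rewrite (_ : h < J) ?eqxx //; have := ltn_ord h; lia.
- case/andP=> /eqP-> _; exists (inl (inr (i1, c1))) => -[[[l a]|y]|b'] //=.
    by rewrite eqxx.
  by rewrite ?toggle_on ?toggle_off.
Qed.

Lemma gadget_graph_cubical s : 1 < J -> cubical (gadget_graph s).
Proof.
move=> J_gt1; apply: (@cubical_of_toggles (gadget_graph s) coord position).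
  by move=> u v; apply: position_inj.
move=> u v /orP[] /position_link[e toggle_e]; exists e => x //.
by rewrite eq_sym toggle_e.
Qed.

(** * Gadget graphs are not layered *)

(** [J] odd makes the tails even paths, so that all hubs are on the side of the
    apex; [5 < J] is what [2 * J <= J + 5] contradicts. *)
Lemma gadget_graph_not_layered s :
    5 < J -> odd J -> (forall th, proper_labelling th -> has (rainbow th) s) ->
  ~ layered (gadget_graph s).
Proof.
move=> J_gt5 J_odd hit_s [m [h [f [f_inj f_adj]]]].
pose F v : {ffun 'I_m -> bool} := val (f v).
have F_layer v : in_layer h (F v) by apply: valP (f v).
have F_edge u v : edge true s u v -> cube_adj (F u) (F v) by apply: f_adj.
have F_link u v : link true s u v -> cube_adj (F u) (F v).
  by move=> uv; apply: F_edge; rewrite /edge uv.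
have F_inj : injective F by move=> u v /val_inj/f_inj.
have hdist_link u v : link true s u v -> hdist (F u) (F v) = 1.
  by move=> /F_link/eqP.
pose side v := upper h (F v).
have side_link u v : link true s u v -> side v = ~~ side u.
  by move=> /F_link/(layer_edge (F_layer u) (F_layer v))[].
have tail b t (lt_t : t < J) : hdist (F Apex) (F (Tail b (Ordinal lt_t))) <= t.+1
    /\ side (Tail b (Ordinal lt_t)) = side Apex (+) ~~ odd t.
  elim: t lt_t => [|t IHt] lt_t.
    have l0 : link true s Apex (Tail b (Ordinal lt_t)) by [].
    by rewrite hdist_link // (side_link _ _ l0) addbT.
  have [le_t side_t] := IHt (ltnW lt_t).
  have lt1 : link true s (Tail b (Ordinal (ltnW lt_t))) (Tail b (Ordinal lt_t)).
    by rewrite /= !eqxx.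
  rewrite (side_link _ _ lt1) side_t -addbN /=; split=> //.
  apply: leq_trans (hdist_triangle (F (Tail b (Ordinal (ltnW lt_t)))) _ _) _.
  by rewrite (hdist_link _ _ lt1) addn1 ltnS; apply: le_t.
have hub b : hdist (F Apex) (F (Hub b)) <= J.+1 /\ side (Hub b) = side Apex.
  have lt_J : J.-1 < J by lia.
  have [le_t side_t] := tail b _ lt_J.
  have l1 : link true s (Tail b (Ordinal lt_J)) (Hub b).
    by rewrite /= eqxx prednK ?eqxx //; lia.
  rewrite (side_link _ _ l1) side_t; split.
    apply: leq_trans (hdist_triangle (F (Tail b (Ordinal lt_J))) _ _) _.
    by rewrite (hdist_link _ _ l1); lia.
  have -> : odd J.-1 = false by lia.
  by case: (side Apex).
(* The coordinate in which a hub differs from one of its leaves. *)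
pose ev (z : facet * 'I_N) := [pick j | F (Hub z.1) j != F (Leaf z.1 z.2) j].
have evP z : exists j, [/\ ev z = Some j, F (Hub z.1) j = side Apex,
    F (Leaf z.1 z.2) j = ~~ side Apex
    & forall i, i != j -> F (Leaf z.1 z.2) i = F (Hub z.1) i].
  have l1 : link true s (Leaf z.1 z.2) (Hub z.1) by rewrite /= eqxx.
  have := F_link _ _ l1; rewrite (@cube_adj_sym m) => e1.
  have [_ [j [xj yj eq_xy]]] := layer_edge (F_layer _) (F_layer _) e1.
  have [_ side_hub] := hub z.1.
  exists j; rewrite /ev -side_hub; split; [| exact: xj | exact: yj | exact: eq_xy].
  case: pickP => [i | /(_ j)]; last by rewrite xj yj; case: upper.
  by have [-> // | /eq_xy->] := eqVneq i j; rewrite eqxx.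
(* The label of [z] is a canonical representative of the pairs with the same
   coordinate as [z]. *)
pose th : labelling := [ffun z => if ev z is Some j then
  if F Apex j == side Apex then [pick z' | ev z' == Some j] else None else None].
have th_ev z z' : th z != None -> th z = th z' -> ev z = ev z'.
  rewrite !ffunE; have [j [-> _ _ _]] := evP z; have [j' [-> _ _ _]] := evP z'.
  case: ifP => // _; case: pickP => // z1 /eqP ev1 _.
  by case: ifP => // _; case: pickP => // z2 /eqP ev2 [eq_z]; rewrite -ev1 -ev2 eq_z.
have ev_inj b : injective (fun c => ev (b, c)).
  move=> c c'; have [j [-> hj lj eq_j]] := evP (b, c).
  have [j' [-> hj' lj' eq_j']] := evP (b, c') => -[eq_jj].
  suffices /F_inj[] : F (Leaf b c) = F (Leaf b c') by [].
  apply/ffunP => i; have [-> | neq_i] := eqVneq i j; first by rewrite lj {1}eq_jj lj'.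
  by rewrite eq_j // eq_j' -?eq_jj.
have some_inj : injective (@Some 'I_m) by move=> j j' [].
have /hit_s/hasP[[w cc] s_w /andP[/forallP/= rb_w /injectiveP/= inj_w]] :
    proper_labelling th.
  apply/forallP => b; apply/andP; split; last first.
    apply/forallP => c; apply/forallP => c'; apply/implyP => /andP[/eqP eq_th thN].
    by apply/eqP/(@ev_inj b)/th_ev.
  have [le_b _] := hub b; apply: leq_trans le_b.
  rewrite -(card_imset _ (@ev_inj b)) /hdist -[leqRHS](card_imset _ some_inj).
  apply/subset_leq_card/subsetP => _ /imsetP[c thN ->].
  have [j [ev_j hj _ _]] := evP (b, c); rewrite ev_j; apply/imset_f.
  move: thN; rewrite !inE ffunE ev_j hj; case: ifP => // _.
  by case: pickP => // /(_ (b, c)); rewrite ev_j eqxx.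
pose A := [set j | (F Apex j == side Apex) && (F (Center w) j != side Apex)].
have walk i : [/\ link true s (Leaf (erase w i) (cc i)) (Hub (erase w i)),
    link true s (Arm w i (cc i)) (Leaf (erase w i) (cc i))
    & link true s (Center w) (Arm w i (cc i))].
  rewrite /= !eqxx; split=> //; apply/hasP; exists (w, cc); rewrite //= !eqxx //.
(* The coordinates of the [J] leaves of the gadget are distinct elements of [A]. *)
have le_JA : J <= #|A|.
  have inj_ev : injective (fun i => ev (erase w i, cc i)).
    move=> i i' eq_ev; apply: inj_w; rewrite !ffunE eq_ev.
    by [].
  rewrite -[J]card_ord -(card_imset _ inj_ev) -(card_imset A some_inj).
  apply/subset_leq_card/subsetP => _ /imsetP[i _ ->].
  have [j [ev_j hj lj _]] := evP (erase w i, cc i); rewrite ev_j; apply/imset_f.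
  have := rb_w i; rewrite !inE ffunE ev_j; case: ifP => //= _ _.
  have [l1 l2 l3] := walk i.
  rewrite (@layer_path3 m h (F (Hub (erase w i))) (F (Leaf (erase w i) (cc i)))
    (F (Arm w i (cc i))) (F (Center w)) j) //= ?hj ?lj; try by case: (side Apex).
  - by rewrite (@cube_adj_sym m); apply: F_link l1.
  - by rewrite (@cube_adj_sym m); apply: F_link l2.
  - by rewrite (@cube_adj_sym m); apply: F_link l3.
  by move/F_inj.
have i0 : 'I_J by apply: (@Ordinal _ 0); lia.
have [l1 l2 l3] := walk i0; have [le_hub side_hub] := hub (erase w i0).
have side_w : upper h (F (Center w)) = ~~ upper h (F Apex).
  rewrite -/(side Apex) -side_hub (side_link _ _ l1) (side_link _ _ l2).
  by rewrite (side_link _ _ l3) !negbK.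
have := opposite_sides (F_layer Apex) (F_layer _) side_w; rewrite -/A.
have le_dist : hdist (F Apex) (F (Center w)) <= J.+1 + 3.
  have step u v d : link true s v u -> hdist (F Apex) (F u) <= d ->
      hdist (F Apex) (F v) <= d.+1.
    move=> /hdist_link d_vu le_d; apply: leq_trans (hdist_triangle (F u) _ _) _.
    by rewrite (hdistC (F u)) d_vu addn1.
  by rewrite !addnS addn0; exact: step l3 (step _ _ _ l2 (step _ _ _ l1 le_hub)).
lia.
Qed.

End Graph.

Theorem theorem1p1 (k : nat) (k_gt0 : 0 < k) :
  exists G : sgraph, girth_at_least G k /\ cubical G /\ ~ layered G.
Proof.
pose J := (2 * k + 6).+1; pose N := 2 * J.+1; pose q := 4 * J ^ 3 * N ^ J.+1.
(* The degree bound is [q * m], where [m] is the binary logarithm of the size of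
   the alphabet.  The number of facets within distance [k] of a given one is thus
   at most polynomial in [m], which [2 ^ m] exceeds. *)
have [m [le_poly le_JN]] := poly_leq_exp2 (2 * J) (J * q) (J * N).+1 k.
pose n := 2 ^ m; pose p := n ^ J.-1; pose z := J * p * N.
have n_gt0 : 0 < n by rewrite expn_gt0.
have p_gt0 : 0 < p by rewrite expn_gt0 n_gt0.
have def_nJ : n ^ J = n * p by rewrite /p -expnS.
have card_z : #|facet J n| * N = z by rewrite card_facet.
have z_gt0 : 0 < z by rewrite !muln_gt0 p_gt0.
have m_gt0 : 0 < m by move: le_JN; case: (m) => //; rewrite ltnNge.
have le_z : z.+1 <= 2 ^ (m * J).
  rewrite expnM -/n def_nJ; apply: leq_trans (leq_mul le_JN (leqnn p)).
  by rewrite mulSn /z mulnAC -addn1 addnC leq_add2r.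
have [|||||||s [girth_s hit_s]] :=
    @exists_rainbow_gadgets J n N k (q * m) (m * J * z).+1.
- by rewrite /J; lia.
- by rewrite /J; lia.
- by rewrite /N.
- rewrite card_z; apply: (@leq_ltn_trans (2 ^ (m * J * z))).
    by rewrite (expnM 2) leq_expn2r.
  by rewrite ltn_exp2l.
- rewrite def_nJ; apply: (@leq_trans (2 * (n * (J * (N ^ J * (2 * (m * J * z))))))).
    have : 0 < m * J * z by rewrite muln_gt0 z_gt0 andbT muln_gt0 m_gt0.
    by move: (m * J * z) => x x_gt0; rewrite !leq_mul //; lia.
  apply: eq_leq; rewrite /q /z (expnS N J) (_ : J ^ 3 = J * (J * J)) //.
  by move: (N ^ J) => x; ring.
- rewrite def_nJ -/p.
  rewrite (mulnA J q m).
  have -> : 2 * (J * p * (1 + J * q * m) ^ k) = 2 * J * (1 + J * q * m) ^ k * p.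
    by ring.
  by rewrite leq_mul2r le_poly orbT.
- by [].
exists (gadget_graph s); split; last split.
- by apply/girth_at_leastP => c /and3P[sz_c cyc_c uniq_c]; apply: girth_s.
- by apply: gadget_graph_cubical; rewrite /J; lia.
by apply: gadget_graph_not_layered => //; rewrite /J; lia.
Qed.
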